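(* Let $\mathcal{H}$ be a Hilbert space of finite dimension $d$ with fixed computational basis $\{|j\rangle\}_{j=1}^d$, and let $f_1=|f_1\rangle\langle f_1|$ with $|f_1\rangle=\frac{1}{\sqrt d}\sum_{j=1}^d|j\rangle$. For any density matrix $\rho$ on $\mathcal{H}$, $$\mathcal{T}_{\mathrm{F}}(\rho)\leqslant\mathcal{T}_{\mathrm{w}}(\rho).$$
   Context: $\mathcal{D}(\mathcal{H})$ is the set of density matrices (positive semidefinite, trace one) on $\mathcal{H}$. The fidelity-based texture measure is $\mathcal{T}_{\mathrm{F}}(\rho)=1-\langle f_1|\rho|f_1\rangle$. The weight-based texture measure is $\mathcal{T}_{\mathrm{w}}(\rho)=\min_s\{s\geqslant 0:\rho=(1-s)f_1+s\tau,\ \tau\in\mathcal{D}(\mathcal{H})\}$, i.e. the minimum of all $s\geqslant 0$ for which there exists $\tau\in\mathcal{D}(\mathcal{H})$ with $\rho=(1-s)f_1+s\tau$. *)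

(* Defs.v *)
From mathcomp Require Import all_boot all_order all_algebra.
From mathcomp Require Import complex.
From mathcomp Require Import classical_sets reals.
From mathcomp Require Import ring lra.
Set Implicit Arguments.
Unset Strict Implicit.
Unset Printing Implicit Defensive.
Import Order.TTheory GRing.Theory Num.Theory.
Local Open Scope classical_set_scope.
Local Open Scope ring_scope.
Local Open Scope complex_scope.
Local Open Scope sesquilinear_scope.

(* In R[i], the complex numbers over the reals R, [0 <= z] means
   that z is a nonnegative real. *)
Definition psdmx (R : realType) (d : nat) (A : 'M[R[i]]_d) : Prop :=
  A \is hermsymmx /\ forall v : 'cV[R[i]]_d, 0 <= (v ^t* *m A *m v) 0 0.

(* There is no density matrix for d = 0, as the trace is then 0; so d > 0 need
   not be assumed separately. *)
Definition density (R : realType) (d : nat) (A : 'M[R[i]]_d) : Prop :=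
  psdmx A /\ \tr A = 1.

Definition ket_f1 (R : realType) (d : nat) : 'cV[R[i]]_d :=
  (sqrtC d%:R)^-1 *: \sum_(j < d) delta_mx j 0.

Definition f1 (R : realType) (d : nat) : 'M[R[i]]_d :=
  ket_f1 R d *m (ket_f1 R d) ^t*.

(* The value is a complex number, real when rho is Hermitian. *)
Definition texture_F (R : realType) (d : nat) (rho : 'M[R[i]]_d) : R[i] :=
  1 - ((ket_f1 R d) ^t* *m rho *m ket_f1 R d) 0 0.

Definition weight_set (R : realType) (d : nat) (rho : 'M[R[i]]_d) : set R :=
  [set s : R | 0 <= s /\ exists2 tau : 'M[R[i]]_d, density tau &
     rho = (1 - s)%:C *: f1 R d + s%:C *: tau].

(* For a density matrix rho this infimum is a minimum: see [texture_w_min]. *)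
Definition texture_w (R : realType) (d : nat) (rho : 'M[R[i]]_d) : R :=
  inf (weight_set rho).

Section Attained.
Variables (R : realType) (d : nat).
Local Notation C := R[i].
Implicit Types (A B : 'M[C]_d) (v : 'cV[C]_d).

Let qf A v : C := (v ^t* *m A *m v) 0 0.

Let qfD A B v : qf (A + B) v = qf A v + qf B v.
Proof. by rewrite /qf mulmxDr mulmxDl mxE. Qed.

Let qfZ a A v : qf (a *: A) v = a * qf A v.
Proof. by rewrite /qf -scalemxAr -scalemxAl mxE. Qed.

Let hermE A : A \is hermsymmx -> forall i j, A i j = Num.conj (A j i).
Proof.
move=> hA i j; have /is_hermitianmxP := hA.
by rewrite expr0 scale1r => /matrixP/(_ i j); rewrite !mxE.
Qed.

Let hermP A : (forall i j, A i j = Num.conj (A j i)) -> A \is hermsymmx.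
Proof.
move=> h; apply/is_hermitianmxP; rewrite expr0 scale1r.
by apply/matrixP => i j; rewrite !mxE.
Qed.

Let conjR (x : R) : Num.conj x%:C = x%:C :> C.
Proof. by apply/conj_Creal; rewrite realE !lecR -realE num_real. Qed.

Let herm_comb (a b : R) A B : A \is hermsymmx -> B \is hermsymmx ->
  a%:C *: A + b%:C *: B \is hermsymmx.
Proof.
move=> hA hB; apply: hermP => i j.
by rewrite !mxE rmorphD !rmorphM /= !conjR -!hermE.
Qed.

Let f1_herm : f1 R d \is hermsymmx.
Proof.
rewrite /f1; move: (ket_f1 R d) => w.
apply: hermP => i j; rewrite !mxE rmorph_sum; apply: eq_bigr => k _.
by rewrite !mxE rmorphM /= conjCK mulrC.
Qed.

Let f1_qf v : 0 <= qf (f1 R d) v.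
Proof.
rewrite /qf /f1; move: (ket_f1 R d) => w; rewrite mulmxA -mulmxA mxE big_ord1.
suff -> : (w ^t* *m v) 0 0 = Num.conj ((v ^t* *m w) 0 0).
  exact: mul_conjC_ge0.
rewrite !mxE rmorph_sum; apply: eq_bigr => k _.
by rewrite !mxE rmorphM /= conjCK mulrC.
Qed.

Let f1_tr : (0 < d)%N -> \tr (f1 R d) = 1.
Proof.
move=> d0; have kE : ket_f1 R d = const_mx (sqrtC d%:R)^-1.
  apply/matrixP => k l; rewrite [RHS]mxE /ket_f1 mxE summxE (bigD1 k) //= big1 ?addr0; last first.
    by move=> j jk; rewrite mxE eq_sym (negPf jk).
  by rewrite mxE (ord1 l) !eqxx mulr1.
rewrite /f1 kE /mxtrace (eq_bigr (fun=> (d%:R : C)^-1)); last first.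
  move=> i _; rewrite mxE big_ord1 !mxE conj_Creal; last first.
    by rewrite realV realE sqrtC_ge0 ler0n.
  by rewrite -expr2 exprVn sqrtCK.
by rewrite sumr_const card_ord -[LHS]mulr_natl mulfV // pnatr_eq0 -lt0n.
Qed.

Let delta_l A i : (delta_mx i 0 : 'cV[C]_d) ^t* *m A = row i A.
Proof.
rewrite rowE; congr (_ *m _); apply/matrixP => k l.
by rewrite !mxE andbC rmorph_nat.
Qed.

Let psd_tr0 A : psdmx A -> \tr A = 0 -> A = 0.
Proof.
move=> [hA pA] trA.
pose E (u v : 'cV[C]_d) : C := (u ^t* *m A *m v) 0 0.
have EDl u w v : E (u + w) v = E u v + E w v.
  rewrite /E (_ : (u + w) ^t* = u ^t* + w ^t*).
    by rewrite !mulmxDl [LHS]mxE.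
  by apply/matrixP => k l; rewrite !mxE rmorphD.
have EDr u v w : E u (v + w) = E u v + E u w by rewrite /E mulmxDr [LHS]mxE.
have EZl a u v : E (a *: u) v = Num.conj a * E u v.
  rewrite /E (_ : (a *: u) ^t* = Num.conj a *: u ^t*).
    by rewrite -!scalemxAl [LHS]mxE.
  by apply/matrixP => k l; rewrite !mxE rmorphM.
have EZr a u v : E u (a *: v) = a * E u v by rewrite /E -scalemxAr [LHS]mxE.
have qd i j : E (delta_mx i 0) (delta_mx j 0) = A i j.
  by rewrite /E delta_l -colE !mxE.
have A0 i : A i i = 0.
  by apply: (psumr_eq0P _ trA) => // k _; rewrite -[X in _ <= X]qd; exact: pA.
apply/matrixP => i j; rewrite [RHS]mxE.
pose c := - Num.conj (A i j).
have := pA (delta_mx i 0 + c *: delta_mx j 0); rewrite -[X in 0 <= X]/(E _ _).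
rewrite EDl !EDr !EZl !EZr !qd !A0 mulr0 mulr0 addr0 add0r (hermE hA j i).
rewrite /c rmorphN /= conjCK.
move=> h; have p := mul_conjC_ge0 (A i j).
apply/eqP; rewrite -mul_conjC_eq0 eq_le p andbT -(@pmulrn_lle0 _ _ 2) //.
rewrite -oppr_ge0 mulr2n opprD; apply: le_trans h _.
by rewrite !mulNr [X in - X + _]mulrC.
Qed.

Let weight_psd rho s : density rho -> 0 <= s ->
  (forall v, 0 <= qf (rho + (s - 1)%:C *: f1 R d) v) -> weight_set rho s.
Proof.
move=> [[hr pr] tr] s0 ps.
have d0 : (0 < d)%N.
  case: (posnP d) tr => // d0; rewrite /mxtrace big1 => [/esym/eqP|i _].
    by rewrite oner_eq0.
  by have := ltn_ord i; rewrite {2}d0.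
have hB (a : R) : rho + a%:C *: f1 R d \is hermsymmx.
  by rewrite -[rho]scale1r; apply: (herm_comb 1).
have trB : \tr (rho + (s - 1)%:C *: f1 R d) = s%:C.
  by rewrite mxtraceD mxtraceZ tr f1_tr // mulr1 rmorphB /= addrC subrK.
split=> //; have [s00|sn0] := eqVneq s 0.
  exists rho => //; rewrite s00 scale0r addr0 subr0 scale1r.
  apply/eqP; rewrite -subr_eq0; apply/eqP.
  have E : rho - f1 R d = rho + (s - 1)%:C *: f1 R d.
    by rewrite s00 sub0r rmorphN scaleN1r.
  by rewrite E; apply: psd_tr0 => //; rewrite trB s00.
have sC0 : s%:C != 0 by rewrite (fmorph_eq0 (real_complex R)).
exists (s^-1%:C *: (rho + (s - 1)%:C *: f1 R d)); last first.
  rewrite scalerA -rmorphM mulfV // scale1r -[1 - s]opprB.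
  by rewrite [(- _)%:C]rmorphN scaleNr addrC addrK.
split; last by rewrite mxtraceZ trB -rmorphM mulVf.
split; last first.
  move=> v; rewrite -[X in 0 <= X]/(qf _ v) qfZ mulr_ge0 // lecR invr_ge0 //.
by rewrite scalerDr scalerA -rmorphM; apply: herm_comb.
Qed.

Lemma texture_w_min (rho : 'M[C]_d) : density rho ->
  weight_set rho (texture_w rho) /\ lbound (weight_set rho) (texture_w rho).
Proof.
move=> dr; have lb0 : lbound (weight_set rho) 0 by move=> s [].
have ne : weight_set rho !=set0.
  exists 1; split=> //; exists rho => //.
  by rewrite subrr scale0r add0r scale1r.
have lbi : lbound (weight_set rho) (texture_w rho).
  by apply: ge_inf; exists 0.
split=> //; apply: weight_psd => //; first exact: lb_le_inf.
move=> v; rewrite qfD qfZ.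
have ge0_real (z : C) : 0 <= z -> exists2 a : R, z = a%:C & 0 <= a.
  by move=> z0; exists (complex.Re z);
    rewrite -?lecR RRe_real // ger0_real.
have [a aE a0] := ge0_real _ (dr.1.2 v); rewrite /qf aE.
have [b bE b0] := ge0_real _ (f1_qf v); rewrite -/(qf _ _) bE.
rewrite -rmorphM -rmorphD /= lecR.
have [->|bn0] := eqVneq b 0; first by rewrite mulr0 addr0.
have bp : 0 < b by rewrite lt0r bn0.
suff : 1 - a / b <= texture_w rho.
  by rewrite lerBlDr -lerBlDl -(ler_pM2r bp) divfK // => h; lra.
apply: lb_le_inf => // s [s0 [tau [[_ ptau] _] rhoE]].
have [t tE t0] := ge0_real _ (ptau v).
have : qf rho v = (1 - s)%:C * qf (f1 R d) v + s%:C * qf tau v.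
  by rewrite {1}rhoE qfD !qfZ.
rewrite {1}/qf aE bE /qf tE -!rmorphM -rmorphD /= => -[aab].
rewrite lerBlDr -lerBlDl ler_pdivlMr //.
have st : 0 <= s * t by exact: mulr_ge0.
rewrite aab; lra.
Qed.
End Attained.

(* Main.v *)
(* Pairing a decomposition [rho = (1 - s) f1 + s tau] with the unit vector
   [|f_1>] gives [1 - <f_1|rho|f_1> = s - s <f_1|tau|f_1> <= s]; the infimum
   defining [texture_w] is attained, so [s] may be taken to be [texture_w rho]. *)
Require Import Defs.
From mathcomp Require Import all_boot all_order all_algebra.
From mathcomp Require Import complex.
From mathcomp Require Import classical_sets reals.
Import Order.TTheory GRing.Theory Num.Theory.
Local Open Scope ring_scope.
Local Open Scope complex_scope.
Local Open Scope sesquilinear_scope.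

Lemma density_dim_gt0 (R : realType) (d : nat) (A : 'M[R[i]]_d) :
  density A -> (0 < d)%N.
Proof.
case: d A => // A [_ /eqP].
by rewrite /mxtrace big_ord0 eq_sym oner_eq0.
Qed.

Lemma ket_f1E (R : realType) (d : nat) :
  ket_f1 R d = const_mx (sqrtC d%:R)^-1.
Proof.
apply/matrixP => k l; rewrite !mxE summxE (bigD1 k) //= big1 => [|j jk].
  by rewrite mxE (ord1 l) !eqxx addr0 mulr1.
by rewrite mxE eq_sym (negPf jk).
Qed.

(** Each of the [d] summands is [|1 / sqrt d|^2 = 1 / d]; positivity of [d] makes [d%:R]
    invertible. *)
Lemma ket_f1_unit (R : realType) (d : nat) :
  (0 < d)%N -> (ket_f1 R d) ^t* *m ket_f1 R d = 1%:M.
Proof.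
move=> d0; rewrite ket_f1E; apply/matrixP => k l.
rewrite !ord1 !mxE (eq_bigr (fun=> (d%:R : R[i])^-1)) => [|j _].
  by rewrite sumr_const card_ord -[LHS]mulr_natl mulfV // pnatr_eq0 -lt0n.
rewrite !mxE conj_Creal; last by rewrite realV realE sqrtC_ge0 ler0n.
by rewrite -expr2 exprVn sqrtCK.
Qed.

(** Stated for every admissible [s], so that attainment of the infimum enters only once, through
    [texture_w_min]. *)
Lemma texture_F_le_weight (R : realType) (d : nat) (rho : 'M[R[i]]_d) (s : R) :
  weight_set rho s -> texture_F rho <= s%:C.
Proof.
move=> [s0 [tau dtau ->]].
have := dtau.1.2 (ket_f1 R d).
have := ket_f1_unit R d (density_dim_gt0 _ _ _ dtau).
(* From here on [k] is any unit vector on which the quadratic form of [tau] is nonnegative. *)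
rewrite /texture_F /f1; move: (ket_f1 R d) => k k1 tau_ge0.
rewrite mulmxDr mulmxDl -!scalemxAr -!scalemxAl mulmxA k1 mul1mx k1.
have -> : ((1 - s)%:C *: 1%:M + s%:C *: (k ^t* *m tau *m k)) 0 0 =
          1 - s%:C + s%:C * (k ^t* *m tau *m k) 0 0.
  (* Abstracting the product as [q] keeps [mxE] from expanding it into sums. *)
  by move: (k ^t* *m _ *m k) => q; rewrite !mxE eqxx mulr1 rmorphB rmorph1.
(* The left side collapses to [s] minus [s] times the form of [tau] at [k]. *)
rewrite opprD addrA opprB addrCA subrr addr0.
by rewrite gerBl mulr_ge0 ?lecR.
Qed.

Theorem proposition6 (R : realType) (d : nat) (rho : 'M[R[i]]_d)
  (rho_density : density rho) : texture_F rho <= (texture_w rho)%:C.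
Proof. exact: texture_F_le_weight (texture_w_min rho_density).1. Qed.
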